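(* Consider perfect $2$-colorings $\{X_1,X_2\}$ of the Johnson graph $J(10,3)$ with quotient matrix $\begin{bmatrix} 12 & 9\\ 9 & 12\end{bmatrix}$. Up to isomorphism, there is exactly one such perfect $2$-coloring having a part of type $0$. This coloring is also, up to isomorphism, the only such perfect $2$-coloring having a part of type $2$.
   Context: The Johnson graph $J(10,3)$ has as vertices the $3$-subsets of $[10]=\{1,\dots,10\}$; two vertices $x,y$ are adjacent when $|x\cap y|=2$. It is regular of valency $21$. A perfect $2$-coloring of $J(10,3)$ with quotient matrix $[p_{i,j}]_{1\le i,j\le 2}$ is a partition of the vertex set into two parts $X_1,X_2$ such that for all $i,j\in\{1,2\}$ every vertex in $X_i$ has exactly $p_{i,j}$ neighbors in $X_j$. Two perfect $2$-colorings (regarded as unordered partitions) are isomorphic if some automorphism of $J(10,3)$, equivalently some permutation of $[10]$ acting on $3$-subsets, maps one partition to the other. Type: for a perfect $2$-coloring with quotient matrix $\begin{bmatrix} 12 & 9\\ 9 & 12\end{bmatrix}$ and a part $X$ of it, $X$ is of type $k\in\{0,1,2\}$ if for all distinct $a,b\in[10]$ the number of $x\in[10]\setminus\{a,b\}$ with $\{a,b,x\}\in X$ is congruent to $k$ modulo $3$. *)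

(* Defs.v *)
From HB Require Import structures.
From mathcomp Require Import all_boot all_order all_fingroup all_algebra.
Set Implicit Arguments.
Unset Strict Implicit.
Unset Printing Implicit Defensive.

(* A simple graph is a symmetric irreflexive relation on a finType; vertex
   partitions are unordered, i.e. sets of (nonempty) parts. *)

(* [partition] forces the parts to be nonempty, and injectivity of [X] forces
   exactly [m] parts; the labelling [X] only ties the parts to the row and
   column indices of the quotient matrix. *)
Definition perfect_coloring (T : finType) (e : rel T) (m : nat)
    (p : 'M[nat]_m) (P : {set {set T}}) : Prop :=
  partition P [set: T] /\
  exists X : 'I_m -> {set T},
    [/\ injective X,
        P = [set X i | i : 'I_m] &
        forall (i j : 'I_m) (v : T),
          v \in X i -> #|[set w in X j | e v w]| = p i j].

Definition graph_automorphism (T : finType) (e : rel T) (s : {perm T}) : Prop :=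
  forall v w : T, e (s v) (s w) = e v w.

Definition isomorphic_partitions (T : finType) (e : rel T)
    (P Q : {set {set T}}) : Prop :=
  exists s : {perm T},
    graph_automorphism e s /\ Q = [set s @: X | X : {set T} in P].

(* The ground set {1, ..., 10} is represented by 'I_10 = {0, ..., 9}. *)
Definition J103 : Type := {x : {set 'I_10} | #|x| == 3}.

HB.instance Definition _ := SubType.on J103.
HB.instance Definition _ := Finite.on J103.

Definition J103_adj : rel J103 := fun x y => #|val x :&: val y| == 2.

Definition quotient_12_9 : 'M[nat]_2 :=
  \matrix_(i < 2, j < 2) (if i == j then 12 else 9).

(* [val @: X] is the family of 3-subsets of the ground set underlying X. *)
Definition of_type (k : nat) (X : {set J103}) : Prop :=
  forall a b : 'I_10, a != b ->
    #|[set x in ~: [set a; b] | [set a; b; x] \in val @: X]| = k %[mod 3].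

Definition has_part_of_type (k : nat) (P : {set {set J103}}) : Prop :=
  exists2 X : {set J103}, X \in P & of_type k X.

(* Main.v *)
(** For a part X, let n(ab) be the number of members of X containing {a,b}.
    Counting pairs inside v shows that n(ab) + n(ac) + n(bc), for v = {a,b,c},
    is the number of neighbours of v in X, plus 3 if v is in X; so {X, X^c} is
    perfect with the given matrix iff this sum is 15 on X and 9 off X. Summing
    over c forces every row sum of n to be 36. If X has type 0, then n takes its
    values in {0,3,6}, and the triangle sums make "equal or n = 3" an equivalence
    relation and "n = 0" a matching; the row sums then force two classes of size 5
    joined by a perfect matching, with n = 6 on the remaining pairs. Hence n, and
    so X, is unique up to a relabelling of the ground set. Since
    n(X^c) = 8 - n(X), complementation exchanges types 0 and 2. *)

Require Import Defs.
From mathcomp Require Import all_boot all_order all_fingroup all_algebra.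
From mathcomp Require Import zify.
Set Implicit Arguments.
Unset Strict Implicit.
Unset Printing Implicit Defensive.

(** * Codegrees of pairs and the weight of a vertex *)

Definition codegree (X : {set J103}) (a b : 'I_10) : nat :=
  if a == b then 0 else #|[set w in X | (a \in val w) && (b \in val w)]|.

(* Every pair of distinct elements of [A] is counted twice, in both orders. *)
Definition weight (T : finType) (n : T -> T -> nat) (A : {set T}) : nat :=
  \sum_(a in A) \sum_(b in A) n a b.

Lemma sum_neq_pairs (T : finType) (A : {set T}) :
  \sum_(a in A) \sum_(b in A) (a != b) = #|A| * #|A|.-1.
Proof.
rewrite -sum_nat_const; apply: eq_bigr => a aA.
rewrite (cardsD1 a) aA /= -sum1_card big_mkcond [RHS]big_mkcond.
by apply: eq_bigr => b _; rewrite !inE eq_sym; case: eqP; case: (b \in A).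
Qed.

Lemma cardJ (v : J103) : #|val v| = 3.
Proof. by apply/eqP/(valP v). Qed.

Lemma meet_full (v w : J103) : (#|val v :&: val w| == 3) = (v == w).
Proof.
apply/eqP/eqP => [h|->]; last by rewrite setIid cardJ.
apply: val_inj; have := subsetIl (val v) (val w); have := subsetIr (val v) (val w).
move=> /subset_cardP; rewrite h cardJ => /(_ erefl)/setP ew.
by move=> /subset_cardP; rewrite h cardJ => /(_ erefl)/setP ev; rewrite -ev ew.
Qed.

(** Double counting: after exchanging sums, each w in X contributes the number of ordered pairs of
    distinct points in the intersection of v and w. *)
Lemma weight_codegree (X : {set J103}) (v : J103) :
  weight (codegree X) (val v) =
  #|[set w in X | J103_adj v w]|.*2 + 6 * (v \in X).
Proof.
have -> : weight (codegree X) (val v) =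
    \sum_(w in X) #|val v :&: val w| * #|val v :&: val w|.-1.
  have E a b : codegree X a b =
      \sum_(w in X) ((a != b) && (a \in val w) && (b \in val w)).
    rewrite /codegree; case: (eqVneq a b) => _ /=; first by rewrite big1.
    rewrite -sum1_card big_mkcond [RHS]big_mkcond; apply: eq_bigr => w _.
    by rewrite inE; case: (w \in X) => //=; case: (_ && _).
  rewrite /weight; under eq_bigr => a _ do under eq_bigr => b _ do rewrite E.
  under eq_bigr => a _ do rewrite exchange_big.
  rewrite exchange_big; apply: eq_bigr => w _; rewrite -sum_neq_pairs.
  rewrite big_mkcond [RHS]big_mkcond; apply: eq_bigr => a _; rewrite inE.
  case: (a \in val v) => //=; case: (a \in val w) => /=; last first.
    by rewrite big1 // => b _; rewrite andbF.
  rewrite big_mkcond [RHS]big_mkcond; apply: eq_bigr => b _; rewrite inE andbT.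
  by case: (b \in val v) => //; case: (b \in val w); rewrite (andbT, andbF).
(* An intersection of size 0, 1, 2, 3 contributes 0, 0, 2, 6; size 2 is adjacency and size 3 is
   equality. *)
rewrite (eq_bigr (fun w : J103 => (J103_adj v w).*2 + 6 * (v == w))); last first.
  move=> w _; rewrite -meet_full /J103_adj.
  have := subset_leq_card (subsetIl (val v) (val w)); rewrite cardJ.
  by case: #|_| => [|[|[|[|]]]].
rewrite big_split /=; congr (_ + _).
  rewrite -sum1_card -mul2n big_distrr /= big_mkcond [RHS]big_mkcond /=.
  by apply: eq_bigr => w _; rewrite !inE; case: (w \in X); case: J103_adj.
rewrite -big_distrr /= big_mkcond /= (bigD1 v) //= eqxx big1 ?addn0.
  by case: (v \in X).
by move=> w /negPf; rewrite eq_sym => ->; case: ifP.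
Qed.

Lemma weight_triple (T : finType) (n : T -> T -> nat) (a b c : T) :
  (forall x, n x x = 0) -> (forall x y, n x y = n y x) ->
  a != b -> a != c -> b != c ->
  weight n [set a; b; c] = (n a b + n a c + n b c).*2.
Proof.
move=> n0 nC ab ac bc.
have E F : \sum_(x in [set a; b; c]) F x = F a + F b + F c.
  rewrite setUC !big_setU1 ?big_set1 ?inE ?negb_or //=; first exact: addnC.
  by rewrite !(eq_sym c) ac bc.
rewrite /weight E !E !n0 (nC b a) (nC c a) (nC c b); lia.
Qed.

Lemma weight_imset (T U : finType) (n : T -> T -> nat) (f : U -> T) (A : {set U}) :
  injective f -> weight n (f @: A) = weight (fun x y => n (f x) (f y)) A.
Proof.
move=> fI; rewrite /weight big_imset /=; last by move=> ? ? _ _ /fI.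
by apply: eq_bigr => a _; rewrite big_imset //= => ? ? _ _ /fI.
Qed.

Lemma codegreeC (X : {set J103}) a b : codegree X a b = codegree X b a.
Proof.
rewrite /codegree eq_sym; case: eqP => // _; apply: eq_card => w.
by rewrite !inE (andbC (a \in _)).
Qed.

Lemma codegree_diag (X : {set J103}) a : codegree X a a = 0.
Proof. by rewrite /codegree eqxx. Qed.

Lemma tripleP (v : J103) :
  exists a b c, [/\ a != b, a != c, b != c & val v = [set a; b; c]].
Proof.
have h := cardJ v.
have /card_gt0P [a av] : 0 < #|val v| by rewrite h.
move: h; rewrite (cardsD1 a) av => -[] /eqP /cards2P [b [c [bc E]]].
have : b \in val v :\ a by rewrite E !inE eqxx.
have : c \in val v :\ a by rewrite E !inE eqxx orbT.
rewrite !inE => /andP[ca _] /andP[ba _].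
exists a, b, c; split=> //; try by rewrite eq_sym.
by rewrite -[LHS](setD1K av) E setUA.
Qed.

Lemma triple_card (T : finType) (a b c : T) :
  a != b -> a != c -> b != c -> #|[set a; b; c]| == 3.
Proof.
by move=> ab ac bc; rewrite setUC cardsU1 cards2 !inE !(eq_sym c) negb_or ab ac bc.
Qed.

Lemma triple_vertex (a b c : 'I_10) :
  a != b -> a != c -> b != c -> exists v : J103, val v = [set a; b; c].
Proof.
move=> ab ac bc; have h := triple_card ab ac bc.
by exists (exist (fun x : {set 'I_10} => #|x| == 3) _ h).
Qed.

(** Bridge to [of_type]: a triple through a and b is determined by its third point. *)
Lemma codegreeE (X : {set J103}) a b : a != b ->
  codegree X a b = #|[set x in ~: [set a; b] | [set a; b; x] \in val @: X]|.
Proof.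
move=> ab; rewrite /codegree (negPf ab) -(card_imset _ val_inj).
rewrite -[RHS](@card_in_imset _ _ (fun x => [set a; b; x])); last first.
  move=> x y; rewrite !inE !negb_or => /andP[/andP[xa xb] _] _ /setP/(_ x).
  by rewrite !inE (negPf xa) (negPf xb) eqxx /= => /esym/eqP.
apply: eq_card => A; apply/imsetP/imsetP => [[w]|[x]].
  rewrite inE => /and3P[wX aw bw] ->.
  have : #|val w :\ a :\ b| = 1.
    have := cardJ w; rewrite (cardsD1 a) aw (cardsD1 b) !inE eq_sym ab bw. by case.
  move/eqP/cards1P => [x E].
  have : x \in val w :\ a :\ b by rewrite E inE.
  rewrite !inE => /and3P[xb xa xw].
  have e : val w = [set a; b; x].
    rewrite -(setD1K aw) -(@setD1K _ b (_ :\ _)) ?E ?setUA //.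
    by rewrite !inE eq_sym ab bw.
  by exists x => //; rewrite !inE (negPf xa) (negPf xb) /= -e imset_f.
rewrite !inE => /andP[_ /imsetP [w wX e]] ->.
by exists w => //; rewrite inE wX -e !inE !eqxx orbT.
Qed.

(** * Complements, and perfect colorings as halved sets *)

Lemma codegree_setC (X : {set J103}) a b : a != b ->
  codegree X a b + codegree (~: X) a b = 8.
Proof.
(* Any of the 10 - 2 remaining points completes the pair to a vertex. *)
move=> ab; have <- : codegree setT a b = 8.
  rewrite codegreeE //; apply/eqP.
  rewrite -(eqn_add2l #|[set a; b]|) {2}cards2 ab.
  rewrite -[X in _ == X](card_ord 10) -(cardsC [set a; b]) eqn_add2l; apply/eqP.
  apply: eq_card => x; rewrite !inE negb_or andb_idr // => /andP[xa xb].
  have [v <-] : exists v : J103, val v = [set a; b; x].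
    by apply: triple_vertex; rewrite // eq_sym.
  by apply: imset_f.
rewrite /codegree (negPf ab) -(cardsID X [set w in setT | _]); congr (_ + _).
  by apply: eq_card => w; rewrite !inE andbC.
by apply: eq_card => w; rewrite !inE.
Qed.

(* 30 = 2 * 15 and 18 = 2 * 9, by [weight_codegree]. *)
Definition halved (X : {set J103}) : Prop :=
  forall v, weight (codegree X) (val v) = if v \in X then 30 else 18.

(** On each triangle the codegree sums of X and of its complement add up to 3 * 8 = 24, so 15 and 9
    are swapped. *)
Lemma halved_setC X : halved X -> halved (~: X).
Proof.
move=> hX v; have := hX v; rewrite inE.
have [a [b [c [ab ac bc ->]]]] := tripleP v.
rewrite !weight_triple //; try exact: codegreeC; try exact: codegree_diag.
have := codegree_setC X ab; have := codegree_setC X ac; have := codegree_setC X bc.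
case: (v \in X) => /=; lia.
Qed.

Lemma halved_neighbors X v : halved X ->
  #|[set w in X | J103_adj v w]| = if v \in X then 12 else 9.
Proof. by move=> /(_ v); rewrite weight_codegree; case: (v \in X); lia. Qed.

Lemma imset_ord2_setC (T : finType) (X : {set T}) :
  [set if i == ord0 then X else ~: X | i : 'I_2] = [set X; ~: X].
Proof.
apply/setP => A; rewrite !inE; apply/imsetP/orP.
  by move=> [i _ ->]; case: ifP => _; rewrite eqxx; [left|right].
by move=> [] /eqP ->; [exists ord0|exists ord_max].
Qed.

Lemma perfect_halved X : halved X -> X != set0 -> X != setT ->
  perfect_coloring J103_adj quotient_12_9 [set X; ~: X].
Proof.
move=> hX X0 XT; have XC : X != ~: X.
  by case/set0Pn: X0 => v vX; apply/eqP => /setP/(_ v); rewrite inE vX.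
split.
  apply/and3P; split.
  - apply/eqP/setP => v; rewrite inE; apply/bigcupP.
    have [vX|vX] := boolP (v \in X); first by exists X; rewrite ?set21.
    by exists (~: X); rewrite ?set22 ?inE.
  - apply/trivIsetP => A B /set2P[]-> /set2P[]->; rewrite ?eqxx // => _.
      by rewrite disjoints_subset setCK.
    by rewrite disjoints_subset.
  - rewrite !inE negb_or eq_sym X0 /= eq_sym; apply: contra XT => /eqP h.
    by rewrite -(setCK X) h setC0.
exists (fun i : 'I_2 => if i == ord0 then X else ~: X); split.
- move=> i j; case: (altP (i =P ord0)) => i0; case: (altP (j =P ord0)) => j0.
  + by rewrite i0 j0.
  + by move=> h; rewrite -h eqxx in XC.
  + by move=> h; rewrite h eqxx in XC.
  + move=> _; apply: val_inj; move: i0 j0.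
    by case: i => [[|[|]]] //; case: j => [[|[|]]].
- by rewrite imset_ord2_setC.
move=> i j v; rewrite !mxE => vi.
(* As v lies in part i, the indices agree exactly when v lies in part j. *)
have -> : (if i == j then 12 else 9) =
    if v \in (if j == ord0 then X else ~: X) then 12 else 9.
  move: vi; case: i => [[|[|]]] // ?; case: j => [[|[|]]] // ?;
    rewrite -!val_eqE /= ?inE.
  - by move=> ->.
  - by move=> ->.
  - by case: (v \in X).
  - by move=> ->.
by case: ifP => _; apply: halved_neighbors => //; apply: halved_setC.
Qed.

(** X may carry either index, which is harmless: the matrix is constant on the diagonal and off
    it. *)
Lemma halved_of_perfect Q X :
  perfect_coloring J103_adj quotient_12_9 Q -> X \in Q ->
  halved X /\ Q = [set X; ~: X].
Proof.
move=> [/and3P[/eqP cQ tQ _] [Y [Yinj QE nY]]].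
rewrite QE => /imsetP[i _ ->].
have part v k l : v \in Y k -> (v \in Y l) = (l == k).
  move=> vk; apply/idP/eqP => [vl|->//]; apply: Yinj; apply: contraTeq (vl) => kl.
  have /trivIsetP/(_ (Y l) (Y k)) := tQ.
  rewrite QE !imset_f // => /(_ isT isT kl) /pred0P/(_ v) /=.
  by rewrite vk andbT => ->.
have cov v : exists k, v \in Y k.
  have : v \in cover Q by rewrite cQ inE.
  by rewrite QE => /bigcupP[_ /imsetP[k _ ->]]; exists k.
split.
  move=> v; have [k vk] := cov v.
  rewrite weight_codegree (nY k i) // (part v k i) // !mxE eq_sym.
  by case: (i == k).
have Yc k : k != i -> Y k = ~: Y i.
  move=> ki; apply/setP => v; rewrite inE; have [l vl] := cov v.
  rewrite (part v l k vl) (part v l i vl); move: ki.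
  by case: i => [[|[|]]] // ?; case: k => [[|[|]]] // ?; case: l {vl} => [[|[|]]] // ?.
apply/setP => A; rewrite !inE; apply/imsetP/orP.
  by move=> [k _ ->]; have [->|/Yc ->] := eqVneq k i; rewrite eqxx; [left|right].
move=> [] /eqP ->; first by exists i.
exists (if i == ord0 then ord_max else ord0) => //; apply/esym/Yc.
by case: (i) => [[|[|]]].
Qed.

(** * The model coloring *)

(* The codegrees of the model part: the classes are {0..4} and {5..9},
   matched by i ~ i + 5. *)
Definition base_nat (i j : nat) : nat :=
  if i == j then 0 else if (i < 5) == (j < 5) then 3
  else if i %% 5 == j %% 5 then 0 else 6.

Definition base (i j : 'I_10) : nat := base_nat i j.

Lemma base_sym i j : base i j = base j i.
Proof.
by rewrite /base /base_nat (eq_sym (i : nat)) (eq_sym (i < 5)) (eq_sym (i %% 5)).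
Qed.

Lemma base_diag i : base i i = 0.
Proof. by rewrite /base /base_nat eqxx. Qed.

(** In a halved set the members are the vertices of weight 30, so the intended codegrees dictate
    this choice. *)
Definition base_part : {set J103} := [set v | weight base (val v) == 30].

(** Since [base_nat] lives on natural numbers, the count of third points becomes a closed boolean
    over [iota 0 10], settled by evaluation. *)
Lemma codegree_base a b : codegree base_part a b = base a b.
Proof.
have [->|ab] := eqVneq a b; first by rewrite codegree_diag base_diag.
pose P (i j x : nat) :=
  [&& x != i, x != j & base_nat i j + base_nat i x + base_nat j x == 15].
have fin : all (fun i => all (fun j => (i != j) ==>
    (count (P i j) (iota 0 10) == base_nat i j)) (iota 0 10)) (iota 0 10) by [].
have lt10 (i : 'I_10) : val i \in iota 0 10 by rewrite mem_iota ltn_ord.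
move: fin => /allP/(_ _ (lt10 a))/allP/(_ _ (lt10 b))/implyP/(_ ab)/eqP.
rewrite -/(base a b) => <-.
rewrite codegreeE // -sum1_count -sum1_card.
rewrite -[iota 0 10]/(index_iota 0 10) big_mkord; apply: eq_bigl => x.
rewrite inE !inE negb_or -andbA; apply: andb_id2l => xa; apply: andb_id2l => xb.
have [v e] : exists v : J103, val v = [set a; b; x].
  by apply: triple_vertex; rewrite // eq_sym.
rewrite -e (mem_imset _ _ val_inj) inE e.
rewrite weight_triple ?(eq_sym _ x) //; try exact: base_sym; try exact: base_diag.
by rewrite -[30]/(15.*2) (inj_eq double_inj).
Qed.

Lemma halved_base : halved base_part.
Proof.
move=> v; rewrite inE.
have -> : weight (codegree base_part) (val v) = weight base (val v).
  by apply: eq_bigr => a _; apply: eq_bigr => b _; apply: codegree_base.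
have [a [b [c [ab ac bc ->]]]] := tripleP v.
rewrite weight_triple //; try exact: base_sym; try exact: base_diag.
have fin : all (fun i => all (fun j => all (fun k => [&& i != j, i != k & j != k] ==>
    (base_nat i j + base_nat i k + base_nat j k \in [:: 9; 15]))
  (iota 0 10)) (iota 0 10)) (iota 0 10) by [].
have lt10 (i : 'I_10) : val i \in iota 0 10 by rewrite mem_iota ltn_ord.
move: fin => /allP/(_ _ (lt10 a))/allP/(_ _ (lt10 b))/allP/(_ _ (lt10 c))/implyP.
rewrite ab ac bc => /(_ isT); rewrite !inE -!/(base _ _).
by case/orP => /eqP ->.
Qed.

(** * Row sums and the classification of codegree functions *)

Lemma codegree_mem_halved X a b c : halved X -> a != b -> a != c -> b != c ->
  codegree X a b + codegree X a c + codegree X b c =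
  if [set a; b; c] \in val @: X then 15 else 9.
Proof.
move=> hX ab ac bc; have [v e] := triple_vertex ab ac bc; have := hX v.
rewrite e weight_triple //; try exact: codegreeC; try exact: codegree_diag.
by rewrite -e (mem_imset _ _ val_inj); case: ifP; lia.
Qed.

(** Sum the triangle sums over the eight points outside {b, c}. Exactly n(bc) of them are 15 instead
    of 9, so 8n(bc) + (S b - n(bc)) + (S c - n(bc)) = 72 + 6n(bc), whence S b + S c = 72. Three
    distinct points then give 36 each. *)
Lemma codegree_row X a : halved X -> \sum_b codegree X a b = 36.
Proof.
move=> hX; set S := fun a => \sum_b codegree X a b.
have pair b c : b != c -> S b + S c = 72.
  move=> bc; pose R z := \sum_(x in ~: [set b; c]) codegree X z x.
  have D z : S z = codegree X z b + (codegree X z c + R z).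
    rewrite /S (bigD1 b) //= (bigD1 c) 1?eq_sym //=; congr (_ + (_ + _)).
    by apply: eq_bigl => x; rewrite !inE negb_or.
  have c8 : #|~: [set b; c]| = 8.
    by have := cardsC [set b; c]; rewrite cards2 bc card_ord => -[].
  have tot :
      \sum_(x in ~: [set b; c]) (codegree X b c + codegree X b x + codegree X c x) =
      72 + 6 * codegree X b c.
    transitivity (\sum_(x in ~: [set b; c]) 9 +
        \sum_(x in ~: [set b; c]) 6 * ([set b; c; x] \in val @: X)).
      rewrite -big_split; apply: eq_bigr => x; rewrite !inE negb_or => /andP[xb xc].
      by rewrite codegree_mem_halved ?(eq_sym _ x) //; case: ifP.
    rewrite sum_nat_const c8; congr (_ + _).
    rewrite codegreeE // -sum1_card !big_distrr /= big_mkcond [RHS]big_mkcond /=.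
    by apply: eq_bigr => x _; rewrite [in RHS]inE; case: (_ \in ~: _); case: (_ \in _).
  move: tot; rewrite !big_split /= sum_nat_const c8 -/(R b) -/(R c).
  rewrite !D !codegree_diag (codegreeC X c b); lia.
have /card_gt1P [b [c []]] : 1 < #|[set~ a]| by rewrite cardsC1 card_ord.
rewrite !inE => ba ca bc.
have := pair _ _ ba; have := pair _ _ ca; have := pair _ _ bc; rewrite /S; lia.
Qed.

Lemma base_labelling (n : 'I_10 -> 'I_10 -> nat) :
  (forall a, n a a = 0) -> (forall a b, n a b = n b a) ->
  (forall a b : 'I_10, a != b -> n a b \in [:: 0; 3; 6]) ->
  (forall a b c, a != b -> a != c -> b != c ->
    n a b + n a c + n b c \in [:: 9; 15]) ->
  (forall a, \sum_b n a b = 36) ->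
  exists2 s : 'I_10 -> 'I_10, injective s & forall i j, n (s i) (s j) = base i j.
Proof.
move=> n0 nC n036 tri row.
pose D (k : nat) (a : 'I_10) : {set 'I_10} := [set b | (b != a) && (n a b == k)].
pose d k a := #|D k a|.
(* Two zeros at a would leave n(bc), at most 6, as the whole triangle sum. *)
have D0 a : d 0 a <= 1.
  apply/card_le1_eqP => c b; rewrite !inE => /andP[ca /eqP nc] /andP[ba /eqP nb].
  apply/eqP; apply/negPn/negP => bc.
  have bN := n036 b c bc.
  have := tri a b c; rewrite !(eq_sym a) nb nc => /(_ ba ca bc).
  by move: bN; rewrite !inE => /or3P[] /eqP ->.
have D9 a : d 0 a + d 3 a + d 6 a = 9.
  transitivity #|[set~ a]|; last by rewrite cardsC1 card_ord.
  rewrite /d -!sum1_card [in LHS]big_mkcond [X in _ + X + _]big_mkcond.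
  rewrite [X in _ + X]big_mkcond [RHS]big_mkcond.
  rewrite -!big_split; apply: eq_bigr => b _; rewrite !inE.
  have [//|ba /=] := eqVneq b a.
  have := n036 a b; rewrite eq_sym => /(_ ba); rewrite !inE.
  by case/or3P => /eqP ->.
have D36 a : 3 * d 3 a + 6 * d 6 a = 36.
  rewrite -(row a) /d -!sum1_card !big_distrr big_mkcond [X in _ + X]big_mkcond.
  rewrite -big_split; apply: eq_bigr => b _; rewrite !inE.
  have [->|ba] /= := eqVneq b a; first by rewrite n0.
  have := n036 a b; rewrite eq_sym => /(_ ba); rewrite !inE.
  by case/or3P => /eqP ->.
pose K (a : 'I_10) : {set 'I_10} := a |: D 3 a.
have KE a b : (b \in K a) = (b == a) || (n a b == 3).
  by rewrite !inE; case: eqP => //= _.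
(* Eliminating [d 6 a] from the two counts gives [d 3 a = 6 - 2 * d 0 a]. *)
have cardK a : #|K a| = 7 - 2 * d 0 a.
  rewrite cardsU1 -/(d 3 a) inE eqxx /=; have := D9 a; have := D36 a; lia.
(* Two sides equal to 3 force the third to be 3, as 6 and 12 are not triangle sums. *)
have Ktr a b c : b \in K a -> c \in K a -> c \in K b.
  rewrite !KE; have [->|ba] := eqVneq b a => //= /eqP nb.
  have [->|ca] /= := eqVneq c a; first by rewrite nC nb orbT.
  move=> /eqP nc; have [//|cb /=] := eqVneq c b.
  have := tri a b c; rewrite !(eq_sym _ c) !(eq_sym a) nb nc => /(_ ba ca cb).
  have := n036 b c; rewrite eq_sym => /(_ cb).
  by rewrite !inE => /or3P[] /eqP ->.
have mate a : exists b, (b != a) && (n a b == 0).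
  suff /card_gt0P [b] : 0 < d 0 a by rewrite inE; exists b.
  (* Otherwise [K a] has 7 points and [d 6 a = 3]. Some b with n(ab) = 6 then has a class disjoint
     from [K a] with at least 5 points: too many for 10. *)
  rewrite lt0n; apply/eqP => d0.
  have /card_gt0P [b] : 0 < d 6 a by have := D9 a; have := D36 a; lia.
  rewrite inE => /andP[ba /eqP nb].
  have dis : [disjoint K a & K b].
    rewrite -setI_eq0; apply/eqP/setP => c; rewrite in_set0 inE; apply/andP => -[ca cb].
    have bb : b \in K b by rewrite KE eqxx.
    have bc := Ktr _ _ _ cb bb.
    have aa : a \in K a by rewrite KE eqxx.
    have := Ktr _ _ _ (Ktr _ _ _ ca aa) bc.
    by rewrite KE (negPf ba) nb.
  have := max_card (mem (K a :|: K b)).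
  rewrite cardsU (disjoint_setI0 dis) cards0 !cardK d0 card_ord; have := D0 b; lia.
have {mate} [mu muP] := fin_all_exists mate.
have mun a : n a (mu a) = 0 by have /andP[_ /eqP] := muP a.
have mua a : a != mu a by have /andP[] := muP a; rewrite eq_sym.
pose A := K ord0; have cA : #|A| = 5.
  have : 0 < d 0 ord0 by apply/card_gt0P; exists (mu ord0); rewrite inE.
  by rewrite cardK; have := D0 ord0; lia.
have A3 a b : a \in A -> b \in A -> a != b -> n a b = 3.
  by move=> aA bA ab; have := Ktr _ _ _ aA bA; rewrite KE eq_sym (negPf ab) => /eqP.
have muA a : a \in A -> mu a \notin A.
  by move=> aA; apply/negP => /(A3 _ _ aA)/(_ (mua a)); rewrite mun.
(* The triangle a, b, [mu b] has sides 3 and 0, so its sum must be 9. *)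
have A6 a b : a \in A -> b \in A -> a != b -> n a (mu b) = 6.
  move=> aA bA ab; have amb : a != mu b by apply: contraNneq (muA _ bA) => <-.
  have := tri a b (mu b) ab amb (mua b); rewrite mun (A3 _ _ aA bA ab).
  by have := n036 _ _ amb; rewrite !inE => /or3P[] /eqP ->.
(* The triangle a, [mu a], [mu b] has sides 0 and 6, so the third is 3. *)
have mu3 a b : a \in A -> b \in A -> a != b -> n (mu a) (mu b) = 3.
  move=> aA bA ab; have amb : a != mu b by apply: contraNneq (muA _ bA) => <-.
  have mab : mu a != mu b.
    by apply: contra_eq_neq (mun a) => ->; rewrite A6.
  have := tri a (mu a) (mu b) (mua a) amb mab; rewrite mun A6 //.
  by have := n036 _ _ mab; rewrite !inE => /or3P[] /eqP ->.
(* Reduction modulo 5 gives i and i + 5 the same point of [A], and keeps the index below [#|A|], so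
   the default is never returned. *)
pose e k := nth ord0 (enum A) (k %% 5).
have eA k : e k \in A by rewrite -mem_enum mem_nth // -cardE cA ltn_mod.
have eI k l : (e k == e l) = (k %% 5 == l %% 5).
  by rewrite nth_uniq ?enum_uniq // -cardE cA ltn_mod.
pose s (i : 'I_10) := if i < 5 then e i else mu (e i).
have sn i j : n (s i) (s j) = base i j.
  have [->|ij] := eqVneq i j; first by rewrite n0 base_diag.
  rewrite /base /base_nat -[val i == val j]/(i == j) (negPf ij) /s.
  have := eI i j; have : i != j :> nat := ij; move: (ltn_ord i) (ltn_ord j).
  case: (ltnP i 5) => i5; case: (ltnP j 5) => j5 /= i10 j10 ij'.
  - have [//|eij _] := eqVneq (e i) (e j); last exact: A3.
    by move/esym/eqP; lia.
  - by have [-> <-|eij <-] := eqVneq (e i) (e j); rewrite ?mun // A6.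
  - by have [-> <-|eij <-] := eqVneq (e i) (e j); rewrite nC ?mun // A6 // eq_sym.
  - have [//|eij _] := eqVneq (e i) (e j); last exact: mu3.
    by move/esym/eqP; lia.
(* A collision forces [base i j = 0], hence i and j in different halves; but [s] sends one half into
   [A] and the other outside it. *)
exists s => // i j sij; apply/eqP; apply/negPn/negP => ij.
have : base i j = 0 by rewrite -sn sij n0.
rewrite /base /base_nat -[val i == val j]/(i == j) (negPf ij).
move: sij; rewrite /s; case: (ltnP i 5) => _; case: (ltnP j 5) => _ //= eij _.
  by have := muA _ (eA j); rewrite -eij eA.
by have := muA _ (eA i); rewrite eij eA.
Qed.

(** * From permutations of the ground set to isomorphic partitions *)

(** The default v is never returned, because a permutation preserves the size 3. *)
Definition lift_vertex (s : {perm 'I_10}) (v : J103) : J103 := insubd v (s @: val v).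

Lemma val_lift_vertex s v : val (lift_vertex s v) = s @: val v.
Proof. by rewrite insubdK // unfold_in card_imset ?cardJ //; apply: perm_inj. Qed.

Lemma lift_vertex_inj s : injective (lift_vertex s).
Proof.
move=> v w /(congr1 val); rewrite !val_lift_vertex => /imset_inj h.
by apply/val_inj/h/perm_inj.
Qed.

Lemma lift_automorphism s : graph_automorphism J103_adj (perm (@lift_vertex_inj s)).
Proof.
move=> v w; rewrite /J103_adj !permE !val_lift_vertex -imsetI;
  last by move=> ? ? _ _ /perm_inj.
by rewrite card_imset //; apply: perm_inj.
Qed.

Lemma halved_type0_isomorphic X : halved X -> of_type 0 X ->
  isomorphic_partitions J103_adj [set base_part; ~: base_part] [set X; ~: X].
Proof.
move=> hX X0; have [|||||s sI sn] := @base_labelling (codegree X).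
- exact: codegree_diag.
- exact: codegreeC.
- move=> a b ab; have := X0 a b ab; rewrite -codegreeE // => /eqP; rewrite mod0n => h.
  (* The complement bounds the codegree by 8, leaving the multiples 0, 3, 6 of 3. *)
  have := codegree_setC X ab; rewrite !inE; lia.
- by move=> a b c ab ac bc; rewrite codegree_mem_halved // !inE; case: ifP.
- by move=> a; apply: codegree_row.
pose t := perm (@lift_vertex_inj (perm sI)).
exists t; split; first exact: lift_automorphism.
(* Both sets consist of the vertices of weight 30, and [t] preserves weights. *)
have tX : t @: base_part = X.
  apply/setP => w; rewrite -(permKV t w) (mem_imset _ _ perm_inj).
  move: (t^-1 w)%g => v; rewrite inE permE.
  have <- : weight (codegree X) (val (lift_vertex (perm sI) v)) = weight base (val v).
    rewrite val_lift_vertex weight_imset; last exact: perm_inj.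
    by apply: eq_bigr => a _; apply: eq_bigr => b _; rewrite !permE sn.
  by rewrite hX; case: (_ \in X).
have tC : t @: (~: base_part) = ~: X.
  apply/setP => w; rewrite -(permKV t w) inE -tX.
  by rewrite !(mem_imset _ _ perm_inj) inE.
by rewrite imsetU1 imset_set1 tX tC.
Qed.

(** * Exchange of types 0 and 2, and the conclusion *)

Lemma of_type_setC X k l : k + l = 8 %[mod 3] -> of_type k X -> of_type l (~: X).
Proof.
move=> kl Xk a b ab; have := Xk a b ab; rewrite -!codegreeE //.
by have := codegree_setC X ab; lia.
Qed.

Theorem theorem12 :
  exists P : {set {set J103}},
    [/\ perfect_coloring J103_adj quotient_12_9 P,
        has_part_of_type 0 P,
        forall Q : {set {set J103}},
          perfect_coloring J103_adj quotient_12_9 Q ->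
          has_part_of_type 0 Q ->
          isomorphic_partitions J103_adj P Q,
        has_part_of_type 2 P &
        forall Q : {set {set J103}},
          perfect_coloring J103_adj quotient_12_9 Q ->
          has_part_of_type 2 Q ->
          isomorphic_partitions J103_adj P Q].
Proof.
have base0 : of_type 0 base_part.
  move=> a b ab; rewrite -codegreeE // codegree_base /base /base_nat.
  by repeat case: ifP.
have uniq0 Q : perfect_coloring J103_adj quotient_12_9 Q -> has_part_of_type 0 Q ->
    isomorphic_partitions J103_adj [set base_part; ~: base_part] Q.
  move=> Qp [X XQ X0]; have [hX ->] := halved_of_perfect Qp XQ.
  exact: halved_type0_isomorphic.
(* A codegree other than 0 and 8 shows that both parts of the model are nonempty. *)
have cod01 : codegree base_part ord0 ord_max = 6 by rewrite codegree_base.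
exists [set base_part; ~: base_part]; split=> //.
- apply: perfect_halved halved_base _ _; apply/eqP => E.
    by move: cod01; rewrite E /codegree /= eq_card0 // => w; rewrite !inE.
  have := codegree_setC base_part (isT : ord0 != ord_max :> 'I_10).
  rewrite cod01 E setCT /codegree /= eq_card0 // => w; by rewrite !inE.
- by exists base_part; rewrite ?set21.
- by exists (~: base_part); rewrite ?set22 //; apply: of_type_setC base0.
(* The other part of [Q] is the complement of X, which has type 0. *)
move=> Q Qp [X XQ X2]; apply: uniq0 => //.
have [_ QE] := halved_of_perfect Qp XQ.
by exists (~: X); [rewrite QE set22 | apply: of_type_setC X2].
Qed.
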